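(* Let $\lambda\in\mathbb{K}$, let $(A,\mathcal{I})$ be a $\lambda$-weighted Rota-Baxter Jacobi-Jordan algebra and let $(V,\mathcal{T})$ (with action $\rho$) be a representation of it. Let $\delta_{RB}^0:\mathcal{A}_{RB}^0(A,V)\to\mathcal{C}_{RB}^1(A,V)$ be given by $\delta_{RB}^0(v)=(\delta^0(v),-v)$, and let $d_{RB}^1$ be the map on $\mathcal{C}^1_{RB}(A,V)$ given by $d_{RB}^1(f,g)=(d^1(f),\,-\tilde d^0(g)-\phi_1^1(f))$. Then $d_{RB}^1\circ\delta_{RB}^0=0$.
   Context: $\mathbb{K}$ is a field of characteristic $0$; all vector spaces and linear maps are over $\mathbb{K}$; $gl(V)$ denotes the space of linear endomorphisms of $V$. A Jacobi-Jordan algebra is a vector space $A$ with a bilinear product $\ast$ such that $x\ast y=y\ast x$ and $(x\ast y)\ast z+(y\ast z)\ast x+(z\ast x)\ast y=0$ for all $x,y,z\in A$. A $\lambda$-weighted Rota-Baxter operator on $(A,\ast)$ is a linear map $\mathcal{I}:A\to A$ with $\mathcal{I}(x)\ast\mathcal{I}(y)=\mathcal{I}(\mathcal{I}(x)\ast y+x\ast\mathcal{I}(y)+\lambda(x\ast y))$ for all $x,y\in A$; then $(A,\mathcal{I})$ is called a $\lambda$-weighted Rota-Baxter Jacobi-Jordan algebra. A representation of a Jacobi-Jordan algebra $A$ is a vector space $V$ with a linear map $\rho:A\to gl(V)$ such that $\rho(x\ast y)=-\rho(x)\rho(y)-\rho(y)\rho(x)$ for all $x,y\in A$. A representation of $(A,\mathcal{I})$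 is a triple $(V,\rho,\mathcal{T})$, written $(V,\mathcal{T})$, where $(V,\rho)$ is a representation of the Jacobi-Jordan algebra $A$ and $\mathcal{T}:V\to V$ is linear with $\rho(\mathcal{I}x)(\mathcal{T}u)=\mathcal{T}(\rho(\mathcal{I}x)u+\rho(x)(\mathcal{T}u)+\lambda\rho(x)u)$ for all $x\in A$, $u\in V$. $A_{\mathcal{I}}$ is the Jacobi-Jordan algebra with underlying space $A$ and product $x\ast_{\mathcal{I}}y=\mathcal{I}(x)\ast y+x\ast\mathcal{I}(y)+\lambda(x\ast y)$, and $\tilde V=(V,\tilde\rho)$ is its representation given by $\tilde\rho(x)u=\rho(\mathcal{I}x)u-\mathcal{T}(\rho(x)u)$. Low-degree cochains: $\mathcal{C}^0(A,V)=\mathcal{A}^0(A,V)=V$, $\mathcal{C}^1(A,V)=\mathrm{Hom}(A,V)$ (linear maps), $\mathcal{C}^2(A,V)$ is the space of symmetric bilinear maps $A\times A\to V$; likewise $\mathcal{C}^0(A_{\mathcal{I}},\tilde V)=V$ and $\mathcal{C}^1(A_{\mathcal{I}},\tilde V)=\mathrm{Hom}(A,V)$. Maps: $(\delta^0v)(x)=\rho(x)v$ for $v\in\mathcal{A}^0(A,V)$; $(d^1f)(x,y)=\rho(x)f(y)+\rho(y)f(x)+f(x\ast y)$ for $f\in\mathcal{C}^1(A,V)$; $(\tilde d^0v)(x)=\tilde\rho(x)v$ for $v\in\mathcal{C}^0(A_{\mathcal{I}},\tilde V)$; $\phi_1^1(f)=f\circ\mathcal{I}-\mathcal{T}\circ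 f$ for $f\in\mathcal{C}^1(A,V)$. Finally $\mathcal{A}_{RB}^0(A,V)=V$, $\mathcal{C}_{RB}^1(A,V)=\mathcal{C}^1(A,V)\oplus\mathcal{C}^0(A_{\mathcal{I}},\tilde V)=\mathrm{Hom}(A,V)\oplus V$, and $d_{RB}^1$ takes values in $\mathcal{C}^2(A,V)\oplus\mathcal{C}^1(A_{\mathcal{I}},\tilde V)$. *)

(* Defs.v *)
From HB Require Import structures.
From mathcomp Require Import all_boot all_order all_algebra.
From mathcomp Require Import boolp functions.

Set Implicit Arguments.
Unset Strict Implicit.
Unset Printing Implicit Defensive.

Import GRing.Theory.
Local Open Scope ring_scope.

Section LinearMaps.
Variables (K : fieldType) (U V : lmodType K).
Implicit Types f g h : {linear U -> V}.

Lemma linear_ext f g : f =1 g -> f = g.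
Proof.
case: f g => [f [[af] [sf]]] [g [[ag] [sg]]] /= /funext efg.
rewrite efg in af sf *.
by rewrite (Prop_irrelevance af ag) (Prop_irrelevance sf sg).
Qed.

HB.instance Definition _ := gen_eqMixin {linear U -> V}.
HB.instance Definition _ := gen_choiceMixin {linear U -> V}.

(* The pointwise vector space structure on Hom(U, V); gl(V) is the case
   U = V. *)
Definition hom_zero : {linear U -> V} := \0.
Definition hom_opp f : {linear U -> V} := \- f.
Definition hom_add f g : {linear U -> V} := f \+ g.
Definition hom_scale (a : K) f : {linear U -> V} := a \*: f.

Fact hom_addA : associative hom_add.
Proof. by move=> f g h; apply: linear_ext => x; rewrite /= addrA. Qed.
Fact hom_addC : commutative hom_add.
Proof. by move=> f g; apply: linear_ext => x; rewrite /= addrC. Qed.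
Fact hom_add0 : left_id hom_zero hom_add.
Proof. by move=> f; apply: linear_ext => x; rewrite /= add0r. Qed.
Fact hom_addN : left_inverse hom_zero hom_opp hom_add.
Proof. by move=> f; apply: linear_ext => x; rewrite /= addNr. Qed.
HB.instance Definition _ := GRing.isZmodule.Build {linear U -> V}
  hom_addA hom_addC hom_add0 hom_addN.

Fact hom_scaleA a b f : hom_scale a (hom_scale b f) = hom_scale (a * b) f.
Proof. by apply: linear_ext => x; rewrite /= scalerA. Qed.
Fact hom_scale1 : left_id 1 hom_scale.
Proof. by move=> f; apply: linear_ext => x; rewrite /= scale1r. Qed.
Fact hom_scaleDr : right_distributive hom_scale +%R.
Proof. by move=> a f g; apply: linear_ext => x; rewrite /= scalerDr. Qed.
Fact hom_scaleDl f : {morph hom_scale^~ f : a b / a + b}.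
Proof. by move=> a b; apply: linear_ext => x; rewrite /= scalerDl. Qed.
HB.instance Definition _ := GRing.Zmodule_isLmodule.Build K {linear U -> V}
  hom_scaleA hom_scale1 hom_scaleDr hom_scaleDl.

Lemma hom_addE f g x : (f + g) x = f x + g x. Proof. by []. Qed.
Lemma hom_oppE f x : (- f) x = - f x. Proof. by []. Qed.
Lemma hom_scaleE a f x : (a *: f) x = a *: f x. Proof. by []. Qed.
Lemma hom_zeroE x : (0 : {linear U -> V}) x = 0. Proof. by []. Qed.

End LinearMaps.

(* Packs a function with a proof that it is linear. *)
Definition mklin (K : fieldType) (U V : lmodType K) (f : U -> V)
    (lf : linear f) : {linear U -> V} :=
  HB.pack f (GRing.isLinear.Build K U V *:%R f lf).

Section SymmetricBilinear.
Variables (K : fieldType) (A V : lmodType K).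

Definition symbil : {pred A -> A -> V} := fun f =>
  `[< (forall x y, f x y = f y x) /\ bilinear_for *:%R *:%R f >].

Lemma symbilP f : reflect
  ((forall x y, f x y = f y x) /\ bilinear_for *:%R *:%R f) (f \in symbil).
Proof. exact: asboolP. Qed.

Fact symbil_submod : submod_closed symbil.
Proof.
split=> [|a f g /symbilP[sf [lf rf]] /symbilP[sg [lg rg]]]; apply/symbilP.
  split=> //; split=> [y b x x'|x b y y']; rewrite /= ?/GRing.zero /=;
  by rewrite scaler0 addr0.
have E x y : (a *: f + g) x y = a *: f x y + g x y by [].
split=> [x y|]; first by rewrite !E sf sg.
have C (u v w z : V) b :
    a *: (b *: u + v) + (b *: w + z) = b *: (a *: u + w) + (a *: v + z).
  by rewrite !scalerDr !scalerA (mulrC a b) addrACA.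
split=> [y b x x'|x b y y']; rewrite !E.
  by rewrite (lf y b x x') (lg y b x x') C.
by rewrite (rf x b y y') (rg x b y y') C.
Qed.
HB.instance Definition _ :=
  GRing.isSubmodClosed.Build K (A -> A -> V) symbil
    (GRing.submod_closed_semi symbil_submod).

Record cochain2 := Cochain2 {
  cochain2_fun :> A -> A -> V;
  _ : cochain2_fun \in symbil }.
HB.instance Definition _ := [isSub for cochain2_fun].
HB.instance Definition _ := [Choice of cochain2 by <:].
HB.instance Definition _ := [SubChoice_isSubLmodule of cochain2 by <:].

End SymmetricBilinear.
Arguments symbil {K} A V.

Section RotaBaxterJacobiJordan.
Variable K : fieldType.

(* A Jacobi-Jordan algebra is a vector space A together with a JJproduct on A,
   so that A and A_I are two products on the same carrier. *)
Record JJproduct (A : lmodType K) := {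
  jj_mul :> {bilinear A -> A -> A};
  jj_mulC : forall x y, jj_mul x y = jj_mul y x;
  jj_jacobi : forall x y z,
    jj_mul (jj_mul x y) z + jj_mul (jj_mul y z) x + jj_mul (jj_mul z x) y = 0 }.

Record RBoperator (lam : K) (A : lmodType K) (mul : JJproduct A) := {
  rb_op :> {linear A -> A};
  rb_opP : forall x y, mul (rb_op x) (rb_op y) =
    rb_op (mul (rb_op x) y + mul x (rb_op y) + lam *: mul x y) }.

Record representation (A : lmodType K) (mul : JJproduct A) (V : lmodType K) := {
  rep_act :> {linear A -> {linear V -> V}};
  rep_actP : forall x y u,
    rep_act (mul x y) u = - rep_act x (rep_act y u) - rep_act y (rep_act x u) }.

Record RBrepresentation (lam : K) (A : lmodType K) (mul : JJproduct A)
    (I : RBoperator lam mul) (V : lmodType K) := {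
  rbr_rep :> representation mul V;
  rbr_op : {linear V -> V};
  rbr_opP : forall x u, rbr_rep (I x) (rbr_op u) =
    rbr_op (rbr_rep (I x) u + rbr_rep x (rbr_op u) + lam *: rbr_rep x u) }.

Section Cochains.
Variables (A : lmodType K) (mul : JJproduct A) (V : lmodType K).
Variable rho : representation mul V.

Fact d0_linear v : linear (fun x => rho x v).
Proof. by move=> a x y; rewrite linearP. Qed.
Definition d0 (v : V) : {linear A -> V} := mklin (d0_linear v).

Definition d1_fun (f : {linear A -> V}) (x y : A) : V :=
  rho x (f y) + rho y (f x) + f (mul x y).

Fact d1_subproof f : d1_fun f \in symbil A V.
Proof.
have S x y : d1_fun f x y = d1_fun f y x.
  by rewrite /d1_fun (jj_mulC mul x) (addrC (rho x _)).
have L y : linear (d1_fun f ^~ y).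
  move=> a x x'; rewrite /d1_fun !linearP linearPl !linearP hom_addE hom_scaleE.
  by rewrite !scalerDr [X in X + _ = _]addrACA [LHS]addrACA.
apply/(symbilP (d1_fun f)); split=> //; split=> [y|x]; first exact: L.
by move=> a y y'; rewrite !(S x); exact: L.
Qed.
Definition d1 (f : {linear A -> V}) : cochain2 A V := Cochain2 (d1_subproof f).

End Cochains.

Section Twisted.
Variables (lam : K) (A : lmodType K) (mul : JJproduct A).
Variable (I : RBoperator lam mul).

Definition twist_fun (x y : A) : A :=
  mul (I x) y + mul x (I y) + lam *: mul x y.

Fact twist_bilinear : bilinear_for *:%R *:%R twist_fun.
Proof.
have C (a : K) (u v w u' v' w' : A) : (a *: u + u') + (a *: v + v') +
    lam *: (a *: w + w') = a *: (u + v + lam *: w) + (u' + v' + lam *: w').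
  rewrite !scalerDr !scalerA (mulrC lam).
  by rewrite [X in X + _ = _]addrACA [LHS]addrACA.
split=> [y a x x'|x a y y']; rewrite /twist_fun.
  by rewrite (linearP I) !linearPl C.
by rewrite (linearP I) !linearPr C.
Qed.
Definition twist_bil : {bilinear A -> A -> A} :=
  HB.pack twist_fun
    (bilinear_isBilinear.Build K A A A *:%R *:%R twist_fun twist_bilinear).

Lemma rb_twist x y : I (twist_fun x y) = mul (I x) (I y).
Proof. by rewrite -rb_opP. Qed.

Fact twist_mulC x y : twist_bil x y = twist_bil y x.
Proof.
rewrite /= /twist_fun (jj_mulC mul x y) (jj_mulC mul (I x)).
by rewrite (jj_mulC mul x (I y)) (addrC (mul y (I x))).
Qed.

Fact twist_jacobi x y z : twist_bil (twist_bil x y) z +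
  twist_bil (twist_bil y z) x + twist_bil (twist_bil z x) y = 0.
Proof.
have E a b c : twist_bil (twist_bil a b) c =
    mul (mul (I a) (I b)) c + mul (mul (I a) b) (I c)
    + mul (mul a (I b)) (I c) + lam *: mul (mul a b) (I c)
    + lam *: mul (mul (I a) b) c + lam *: mul (mul a (I b)) c
    + lam *: (lam *: mul (mul a b) c).
  rewrite /= [LHS]/twist_fun rb_twist /twist_fun !linearDl !linearZl_LR /=.
  by rewrite !scalerDr !addrA.
rewrite !E !addrA (ACl ((1*9*17)*(2*10*15)*(3*8*16)*(4*13*19)*(5*11*20)
  *(6*12*18)*(7*14*21)))%AC /=.
by rewrite -!scalerDr !jj_jacobi !scaler0 !addr0.
Qed.

(* The algebra A_I. *)
Definition twist : JJproduct A := {|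
  jj_mul := twist_bil; jj_mulC := twist_mulC; jj_jacobi := twist_jacobi |}.

Variables (V : lmodType K) (rho : RBrepresentation I V).

Definition twist_act_fun (x : A) (u : V) : V :=
  rho (I x) u - rbr_op rho (rho x u).

Fact twist_act_linearr x : linear (twist_act_fun x).
Proof.
move=> a u v; rewrite /twist_act_fun !linearP.
by rewrite addrACA -scalerDr.
Qed.

Fact twist_act_linearl : linear (fun x => mklin (twist_act_linearr x)).
Proof.
move=> a x y; apply: linear_ext => u.
rewrite hom_addE hom_scaleE /= /twist_act_fun !linearP.
by rewrite hom_addE hom_scaleE addrACA -scalerDr.
Qed.
Definition twist_act : {linear A -> {linear V -> V}} :=
  mklin twist_act_linearl.

Fact twist_actP x y u : twist_act (twist x y) u =
  - twist_act x (twist_act y u) - twist_act y (twist_act x u).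
Proof.
have E a b : twist_act a (twist_act b u) = rho (I a) (rho (I b) u) -
    rbr_op rho (rho (I a) (rho b u) + rho a (rho (I b) u)
                + lam *: rho a (rho b u)).
  rewrite /= /twist_act_fun (linearB (rho (I a))) (linearB (rho a)).
  rewrite (linearB (rbr_op rho)) rbr_opP !(linearD (rbr_op rho)).
  rewrite -addrA -opprD; congr (_ - _).
  by rewrite addrA (ACl (1*4*3*(2*5)))%AC /= subrr addr0.
rewrite !E /= /twist_act_fun rb_twist rep_actP /twist_fun.
rewrite !(linearD rho) (linearZ_LR rho) !hom_addE hom_scaleE !rep_actP.
set T := rbr_op rho.
rewrite !opprB [RHS]addrACA [RHS]addrC; congr (_ + _).
rewrite -(linearD T) -(linearN T); congr (T _).
rewrite -!opprD scalerN -opprD opprK scalerDr.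
by rewrite !addrA (ACl (1*3*5*4*2*6))%AC.
Qed.

(* The representation V~ of A_I. *)
Definition twist_rep : representation twist V := {|
  rep_act := twist_act; rep_actP := twist_actP |}.

Definition phi11 (f : {linear A -> V}) : {linear A -> V} :=
  (f \o I) \- (rbr_op rho \o f).

Definition C1RB : lmodType K := ({linear A -> V} * V)%type.
Definition C2RB : lmodType K := (cochain2 A V * {linear A -> V})%type.

(* delta^0 and d~^0 are the same formula v |-> (x |-> action of x on v), for
   the representation V of A and the representation V~ of A_I respectively. *)
Definition delta0 (v : V) : {linear A -> V} := d0 rho v.
Definition dtilde0 (v : V) : {linear A -> V} := d0 twist_rep v.

Definition delta0RB (v : V) : C1RB := (delta0 v, - v).

Definition d1RB (c : C1RB) : C2RB :=
  (d1 rho c.1, - dtilde0 c.2 - phi11 c.1).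

End Twisted.
End RotaBaxterJacobiJordan.

(* Main.v *)
Require Import Defs.
From HB Require Import structures.
From mathcomp Require Import all_boot all_order all_algebra.
From mathcomp Require Import boolp functions.
Import GRing.Theory.
Local Open Scope ring_scope.

(** The two components of the composite vanish for independent reasons.  The
    [cochain2] component of the image of [v] is d^1(delta^0 v), whose value at
    (x, y) is rho(x) rho(y) v + rho(y) rho(x) v + rho(x * y) v; its vanishing
    is the representation axiom itself ([d1_d0]).  The other component is
    - dtilde^0(- v) - phi^1_1(delta^0 v).  Since phi^1_1 precomposes with the
    Rota-Baxter operator and subtracts postcomposition with the operator of
    the module, applying it to x |-> rho(x) v produces precisely the twisted
    action x |-> rho~(x) v, so that phi^1_1 o delta^0 = dtilde^0
    ([phi11_delta0]).  The sign in delta0RB v = (delta^0 v, - v) then makes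
    the two terms cancel. *)

Lemma d0N (K : fieldType) (A : lmodType K) (mul : JJproduct A)
    (V : lmodType K) (rho : representation mul V) (v : V) :
  d0 rho (- v) = - d0 rho v.
Proof. by apply: linear_ext => x; rewrite hom_oppE /= linearN. Qed.

(** Evaluated at two elements, this is the identity defining a
    representation. *)
Lemma d1_d0 (K : fieldType) (A : lmodType K) (mul : JJproduct A)
    (V : lmodType K) (rho : representation mul V) (v : V) :
  d1 rho (d0 rho v) = 0.
Proof.
apply: val_inj; apply/funext => x; apply/funext => y.
by rewrite /= /d1_fun /= rep_actP -opprD subrr.
Qed.

(** The map phi^1_1 intertwines the two degree-zero differentials: the twisted
    action is defined by the very correction that phi^1_1 applies to a
    1-cochain. *)
Lemma phi11_delta0 (K : fieldType) (lam : K) (A : lmodType K)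
    (mul : JJproduct A) (I : RBoperator lam mul) (V : lmodType K)
    (rho : RBrepresentation I V) (v : V) :
  phi11 rho (delta0 rho v) = dtilde0 rho v.
Proof. exact: linear_ext. Qed.

Theorem proposition4p2 (K : fieldType) (charK0 : [pchar K] =i pred0)
    (lam : K) (A : lmodType K) (mul : JJproduct A) (I : RBoperator lam mul)
    (V : lmodType K) (rho : RBrepresentation I V) :
  d1RB rho \o delta0RB rho = 0.
Proof.
apply/funext => v; rewrite /= /d1RB /= d1_d0 phi11_delta0.
by rewrite /dtilde0 d0N opprK subrr.
Qed.
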